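(* Let $X$ be a hereditarily locally connected continuum and let $f:X\to X$ be a homeomorphism. Then every point $x\in X\setminus\Omega(f)$ is an equicontinuous point of $(X,f)$.
   Context: A continuum is a nonempty connected compact metric space; it is hereditarily locally connected if each of its subcontinua is locally connected. For a continuous map $f:X\to X$ of a compact metric space $(X,d)$, a point $x$ is wandering for $f$ if there is a neighborhood $U$ of $x$ with $f^{-n}(U)\cap U=\emptyset$ for every integer $n\ge 1$; otherwise $x$ is non-wandering, and $\Omega(f)$ is the set of non-wandering points. A point $x$ is an equicontinuous point of $(X,f)$ if for any $\varepsilon>0$ there is $\delta>0$ such that for any $y\in B(x,\delta)$ one has $d(f^n(x),f^n(y))<\varepsilon$ for all integers $n\ge 0$, where $B(x,\delta)$ is the open ball of center $x$ and radius $\delta$. *)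

(* Defs.v *)
From mathcomp Require Import all_boot all_order all_algebra.
From mathcomp Require Import all_classical all_reals topology.

Set Implicit Arguments.
Unset Strict Implicit.
Unset Printing Implicit Defensive.

Import Order.TTheory GRing.Theory Num.Theory.
Local Open Scope classical_set_scope.
Local Open Scope ring_scope.

Definition continuum {R : realType} {X : metricType R} (A : set X) : Prop :=
  [/\ A !=set0, connected A & compact A].

(* The subspace A has a base of connected open sets: the open sets of A are
   the traces A `&` V of open sets V of X, and connectedness of A `&` V does not
   depend on whether it is taken in A or in X. *)
Definition locally_connected {X : topologicalType} (A : set X) : Prop :=
  forall (x : X) (U : set X), A x -> nbhs x U ->
    exists V : set X,
      [/\ open V, V x, connected (A `&` V) & A `&` V `<=` U].

Definition hereditarily_locally_connected_continuum {R : realType}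
    (X : metricType R) : Prop :=
  continuum [set: X] /\
  forall A : set X, continuum A -> locally_connected A.

Definition homeomorphism {X Y : topologicalType} (f : X -> Y) : Prop :=
  continuous f /\
  exists g : Y -> X, [/\ continuous g, cancel f g & cancel g f].

Definition wandering {X : topologicalType} (f : X -> X) (x : X) : Prop :=
  exists2 U : set X, nbhs x U &
    forall n : nat, (1 <= n)%N -> (iter n f @^-1` U) `&` U = set0.

Definition nonwandering_set {X : topologicalType} (f : X -> X) : set X :=
  [set x | ~ wandering f x].

Definition equicontinuous_point {R : realType} {X : metricType R}
    (f : X -> X) (x : X) : Prop :=
  forall e : R, 0 < e -> exists2 d : R, 0 < d &
    forall y : X, ball x d y ->
      forall n : nat, mdist (iter n f x) (iter n f y) < e.

(* Main.v *)
Require Import Defs.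
From mathcomp Require Import all_boot all_order all_algebra.
From mathcomp Require Import all_classical all_reals topology.
From mathcomp Require Import lra.

(* A wandering point has a connected neighborhood whose iterates lie in pairwise
   disjoint open sets.  In a hereditarily locally connected continuum, the
   diameters of such iterates tend to 0, which leaves only finitely many iterates
   to control by continuity. *)

Import Order.TTheory GRing.Theory Num.Theory.
Local Open Scope classical_set_scope.
Local Open Scope ring_scope.

(** The two inclusions make [A]&[C] and [A]&[U] the same set, so this nonempty trace is clopen in
    the connected set [A]. *)
Lemma connected_subset_closed {T : topologicalType} {A U C : set T} :
  connected A -> open U -> closed C -> A `&` U `<=` C -> C `<=` U ->
  A `&` C !=set0 -> A `<=` C.
Proof.
move=> cA oU cC AUC CU AC0.
have AUE : A `&` C = A `&` U.
  apply/seteqP; split=> z [Az ?]; split=> //; first exact: CU.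
  exact: AUC.
have <- : A `&` C = A by apply: cA => //; [exists U | exists C].
by move=> z [].
Qed.

(* Otherwise pairs [(p_n, q_n)] of distant points of infinitely many [C n]
   accumulate at some [(p, q)].  The closure of the union of a small connected
   neighborhood of [p] with the [C n] meeting it is a continuum; near [q] each
   [C n] is clopen in it, so it is not locally connected at [q]. *)
Lemma hlc_null_sequence {R : realType} {X : metricType R} {U C : nat -> set X} :
  hereditarily_locally_connected_continuum X ->
  (forall n, open (U n)) -> (forall n, closed (C n)) ->
  (forall n, connected (C n)) -> (forall n, C n `<=` U n) ->
  (forall n m x, U n x -> U m x -> n = m) ->
  forall e : R, 0 < e -> exists N, forall n, (N <= n)%N ->
    forall x y, C n x -> C n y -> mdist x y < e.
Proof.
move=> [cX lcX] oU cC connC CU disjU e e0; apply: contrapT => noN.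
have [k /all_and4[lek Cx Cy xy_far]] : {k : nat -> nat * (X * X) & forall N,
    [/\ (N <= (k N).1)%N, C (k N).1 (k N).2.1, C (k N).1 (k N).2.2
      & ~ mdist (k N).2.1 (k N).2.2 < e]}.
  apply: (choice (P := fun N (k : nat * (X * X)) => [/\ (N <= k.1)%N,
    C k.1 k.2.1, C k.1 k.2.2 & ~ mdist k.2.1 k.2.2 < e])) => N.
  apply: contrapT => noP; apply: noN; exists N => n Nn x y nx ny.
  by apply: contrapT => far; apply: noP; exists (n, (x, y)).
have [_ _ compX] := cX.
have [[p q] [_ pq_clu]] : [set: X] `*` [set: X] `&`
    cluster ((fun N => (k N).2) @ \oo) !=set0.
  by apply: (compact_setX compX compX); apply: filterE.
have near_pq (N : nat) (A B : set X) : nbhs p A -> nbhs q B ->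
    exists2 n, (N <= n)%N & exists x y, [/\ A x, B y, C n x, C n y
      & ~ mdist x y < e].
  move=> pA qB.
  have [||_ /= [[i Ni <-] [Ai Bi]]] :=
    pq_clu [set (k i).2 | i in [set i | (N <= i)%N]] (A `*` B).
  - by exists N => // i Ni; exists i.
  - by exists (A, B).
  exists (k i).1; first exact: leq_trans Ni (lek i).
  by exists (k i).2.1, (k i).2.2; split.
(* With radius [e / 8], [p] and [q] stay at least [6 * (e / 8)] apart, while a point near [p] within
   [e / 8] of a point near [q] would put them less than [3 * (e / 8)] apart. *)
have e8 : 0 < e / 8 by lra.
have ball_nbhs (z : X) : nbhs z (ball z (e / 8)) by exact: nbhsx_ballx.
have ballE (z w : X) : ball z (e / 8) w -> mdist z w < e / 8.
  by rewrite ballEmdist.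
have [V [oV Vp connV Vsmall]] := lcX setT cX p _ I (ball_nbhs p).
rewrite setTI in connV Vsmall.
have pV : nbhs p V by exact: open_nbhs_nbhs.
pose J := [set n | V `&` C n !=set0].
(* Each piece is [V]|[C n] rather than [C n], so that all pieces are connected and share the point
   [p]. *)
pose M := closure (\bigcup_(n in J) (V `|` C n)).
have Mq : M q.
  move=> B qB; have [n _ [x [y [Vx By Cnx Cny _]]]] := near_pq 0%N V B pV qB.
  by exists y; split=> //; exists n; [exists x | right].
have contM : continuum M.
  split; first by exists q.
    apply: connected_closure; apply: bigcup_connected.
      by exists p => n _; left.
    by move=> n Jn; apply: connectedU.
  by apply: (subclosed_compact _ compX) => //; exact: closed_closure.
have [W [oW Wq connW Wsmall]] := lcX M contM q _ Mq (ball_nbhs q).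
have qW : nbhs q W by exact: open_nbhs_nbhs.
have pq_far : 6 * (e / 8) <= mdist p q.
  have [_ _ [x [y [/ballE px /ballE qy _ _ /negP]]]] :=
    near_pq 0%N _ _ (ball_nbhs p) (ball_nbhs q).
  rewrite -leNgt => exy.
  have := metric_triangle x p y; have := metric_triangle p q y.
  rewrite (metric_sym x p); lra.
have WUC n : (M `&` W) `&` U n `<=` C n.
  move=> z [MWz Unz]; apply: contrapT => nCz.
  have [|w [[m _ [Vw|Cmw]] [[Unw nCw] zw]]] :=
      MWz.1 ((U n `&` ~` C n) `&` ball z (e / 8)).
  - apply: filterI => //; apply: open_nbhs_nbhs; split => //.
    by apply: openI => //; exact: closed_openC.
  - have := ballE _ _ (Vsmall _ Vw); have := ballE _ _ (Wsmall _ MWz).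
    have := ballE _ _ zw; have := metric_triangle p w q.
    have := metric_triangle w z q; rewrite (metric_sym w z) (metric_sym z q).
    lra.
  - by apply: nCw; rewrite (disjU n m w Unw (CU _ _ Cmw)).
have WC (N : nat) : exists2 n, (N <= n)%N & M `&` W `<=` C n.
  have [n Nn [x [y [Vx Wy Cnx Cny _]]]] := near_pq N V W pV qW.
  exists n => //.
  apply: connected_subset_closed (oU n) (cC n) (WUC n) (CU n) _ => //.
  exists y; split=> //; split=> //; apply: subset_closure.
  by exists n; [exists x | right].
(* The point [q] of [M]&[W] thus lies in [C n] for two different indices. *)
have [n _ MWn] := WC 0%N; have [m nm MWm] := WC n.+1.
have /eqP : n = m by apply: (disjU n m q); apply: CU; [apply: MWn|apply: MWm].
by rewrite ltn_eqF.
Qed.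

Lemma iter_continuous {T : topologicalType} {f : T -> T} (n : nat) :
  continuous f -> continuous (iter n f).
Proof.
move=> cf; elim: n => [|n IHn] x /=; first exact: cvg_id.
by apply: continuous_comp; [exact: IHn | exact: cf].
Qed.

Lemma iter_cancel {T : Type} {f g : T -> T} (n : nat) :
  cancel f g -> cancel (iter n f) (iter n g).
Proof. by move=> fK; elim: n => // n IHn x; rewrite iterSr /= fK IHn. Qed.

Theorem proposition3p10 (R : realType) (X : metricType R) (f : X -> X)
    (hX : hereditarily_locally_connected_continuum X)
    (hf : homeomorphism f) (x : X) (hx : (~` nonwandering_set f) x) :
  equicontinuous_point f x.
Proof.
have [cf [g [cg fK gK]]] := hf; move: hx => /contrapT[U0 xU0 disjU0].
move: xU0; rewrite nbhsE => -[U [oU Ux] UU0].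
have [V xV VU] : exists2 V, nbhs x V & closure V `<=` U.
  by apply: (uniform_regular (open_nbhs_nbhs (conj oU Ux))).
have [W [oW Wx connW WV]] := hX.2 setT hX.1 x V I xV.
rewrite setTI in connW WV.
have giter_cont n : continuous (iter n g).
  exact: iter_continuous.
(* The iterates [f^n(U)] and [f^n(closure W)] are written as preimages under [g^n], so that
   continuity of [g^n] makes them open and closed. *)
have null e : 0 < e -> exists N, forall n, (N <= n)%N -> forall y z,
    closure W (iter n g y) -> closure W (iter n g z) -> mdist y z < e.
  apply: (@hlc_null_sequence R X (fun n => iter n g @^-1` U)
    (fun n => iter n g @^-1` closure W) hX).
  - move=> n; apply: open_comp => // y _; exact: giter_cont.
  - move=> n; apply: preimage_closed; last exact: closed_closure.
    by move=> y _; exact: giter_cont.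
  - move=> n.
    have -> : iter n g @^-1` closure W = iter n f @` closure W.
      apply/seteqP; split=> [y Wy|_ [y Wy <-]] /=; last by rewrite iter_cancel.
      by exists (iter n g y) => //; rewrite iter_cancel.
    apply: connected_continuous_connected; first exact: connected_closure.
    by apply: continuous_subspaceT; exact: iter_continuous.
  - by move=> n; apply: preimage_subset; apply: subset_trans VU; exact: closureS.
  (* The point [g^m y] of [U] would return to [U] after [m - n] steps of [f], at [g^n y]. *)
  - have lt_disj n m y : (n < m)%N -> U (iter n g y) -> U (iter m g y) -> False.
      move=> nm Un Um.
      have nm0 : (1 <= m - n)%N by rewrite subn_gt0.
      have := disjU0 _ nm0; rewrite -subset0 => /(_ (iter m g y)); apply.
      split=> /=; last exact: UU0.
      rewrite -(subnK (ltnW nm)) iterD addnK iter_cancel //; exact: UU0.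
    move=> n m y Un Um; case: (ltngtP n m) => // ?; exfalso.
      exact: (lt_disj n m y).
    exact: (lt_disj m n y).
move=> e e0; have [N nullN] := null e e0.
have xW : nbhs x W by exact: open_nbhs_nbhs.
have initial : \forall y \near x, forall n, (n < N)%N ->
    mdist (iter n f x) (iter n f y) < e.
  elim: N {nullN} => [|N IHN]; first exact: filterE.
  have := iter_continuous N cf x _ (nbhsx_ballx (iter N f x) e e0).
  apply: filterS2 IHN => y yN; rewrite ballEmdist => dN n.
  by rewrite ltnS leq_eqVlt => /orP[/eqP ->|/yN].
have [d /= d0 dP] := (nbhs_ballP x _).1 (filterI xW initial).
(* From time [N] on, both orbits lie in the same small set [f^n(closure W)]; earlier times are
   covered by [initial]. *)
exists d => // y /dP[Wy yN] n; case: (ltnP n N) => [/yN //|Nn].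
by apply: (nullN n Nn); apply: subset_closure; rewrite iter_cancel.
Qed.
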